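(* Let $X$ be a topological space and $B\subset A\subset X$ with $\mathrm{Cl}(B)\subset\mathrm{Int}(A)$, and let $i:(X\setminus B,A\setminus B)\hookrightarrow(X,A)$ be the inclusion. Let $L=1$ and $\vec m=(a,b)\in\mathcal R^2$ where $(a,b)$ satisfies condition $\mathcal{NCD}$. Then for every $n\ge0$ the induced map $i_*:{}_{\vec m}\mathcal H_n(X\setminus B,A\setminus B)\to{}_{\vec m}\mathcal H_n(X,A)$ is an isomorphism.
   Context: $\mathcal R$ is a commutative ring with unit. $(a,b)\in\mathcal R^2$ satisfies $\mathcal{NCD}$ if for every $n\in\mathbb N$ there exist $x_n,y_n\in\mathcal R$ with $x_na^n+y_nb^n=1_{\mathcal R}$. For a space $X$: $\mathcal S_n(X)$ = continuous maps $[0,1]^n\to X$ ($[0,1]^0=\{0\}$), $\mathcal K_n(X)$ the free $\mathcal R$-module on $\mathcal S_n(X)$, $\mathcal K_{-1}(X)=0$. With $L=1$, for $n\ge1$, $T\in\mathcal S_n(X)$, $i\in\{0,1\}$, $1\le j\le n$: $\langle T\rangle_{n,i,j}(x_1,\dots,x_{n-1})=T(x_1,\dots,x_{j-1},i,x_j,\dots,x_{n-1})$ (for $n=1$: $\langle T\rangle_{1,i,1}(0)=T(i)$), and $\partial_n(T)=\sum_{j=1}^n(-1)^{j+1}(a\langle T\rangle_{n,0,j}+b\langle T\rangle_{n,1,j})$, extended linearly, $\partial_0=0$; $\partial\circ\partial=0$. For a pair $(X,A)$, $\mathcal K_n(X,A)=\mathcal K_n(X)/\mathcal K_n(A)$ with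 the induced boundary, and ${}_{\vec m}\mathcal H_n(X,A)=\ker\partial_n/\operatorname{im}\partial_{n+1}$; a map of pairs $f$ induces $f_*$ via $T\mapsto f\circ T$. *)

(* Defs.v *)
From HB Require Import structures.
From mathcomp Require Import all_boot all_order all_algebra.
From mathcomp Require Import all_classical all_reals all_analysis.
Set Implicit Arguments. Unset Strict Implicit. Unset Printing Implicit Defensive.
Import Order.TTheory GRing.Theory Num.Theory.
Import numFieldNormedType.Exports.
Local Open Scope classical_set_scope.
Local Open Scope ring_scope.

(* R  : the real numbers (any realType), used for the cube [0,1]^n (L = 1).
   Rg : the commutative coefficient ring (the paper's \mathcal R).        *)

Section Cubical.
Variables (R : realType) (Rg : comNzRingType) (X : topologicalType).

Definition cube (n : nat) : set 'rV[R]_n :=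
  [set x | forall i, 0 <= x ord0 i <= 1].

Definition clamp (n : nat) (x : 'rV[R]_n) : 'rV[R]_n :=
  \row_i Num.min 1 (Num.max 0 (x ord0 i)).

(* A singular n-cube in Y (a subset of X, with the subspace topology) is a
   continuous map [0,1]^n -> Y.  We represent it canonically by the unique
   clamp-invariant extension T : 'rV_n -> X. *)
Definition is_cube (n : nat) (Y : set X) (T : 'rV[R]_n -> X) : Prop :=
  [/\ {within @cube n, continuous T},
      (forall x, T x = T (clamp x)) &
      (forall x, Y (T x))].

Definition ins (m : nat) (j : 'I_m.+1) (v : R) (x : 'rV[R]_m) : 'rV[R]_m.+1 :=
  \row_k match unlift j k with None => v | Some k' => x ord0 k' end.

Definition face (m : nat) (j : 'I_m.+1) (i : bool) (T : 'rV[R]_m.+1 -> X)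
  : 'rV[R]_m -> X := fun x => T (ins j (if i then 1 else 0) x).

(* formal finite R-linear combinations of maps; an element of the free module
   is determined by its coefficient function [coef]. *)
Definition chain (n : nat) := seq (Rg * ('rV[R]_n -> X)).

Definition coef (n : nat) (c : chain n) (U : 'rV[R]_n -> X) : Rg :=
  \sum_(p <- c) (if pselect (p.2 = U) then p.1 else 0).

Definition chain_eq (n : nat) (c d : chain n) : Prop :=
  forall U, coef c U = coef d U.

Definition chain_add (n : nat) (c d : chain n) : chain n := c ++ d.

Definition chain_sub (n : nat) (c d : chain n) : chain n :=
  c ++ [seq (- p.1, p.2) | p <- d].

Definition inK (n : nat) (Y : set X) (c : chain n) : Prop :=
  forall U, coef c U != 0 -> is_cube Y U.

Definition bd (a b : Rg) (m : nat) (c : chain m.+1) : chain m :=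
  flatten [seq flatten [seq [:: ((-1) ^+ j * a * p.1, face j false p.2);
                                 ((-1) ^+ j * b * p.1, face j true p.2)]
                        | j : 'I_m.+1 <- enum 'I_m.+1] | p <- c].

(* relative cycles of (Y, Z): chains of K_n(Y) whose image in
   K_n(Y)/K_n(Z) lies in ker d_n (d_0 = 0) *)
Definition relcycle (a b : Rg) (Y Z : set X) (n : nat) : chain n -> Prop :=
  match n with
  | 0 => fun c => inK Y c
  | m.+1 => fun c => inK Y c /\ inK Z (bd a b c)
  end.

(* relative boundaries of (Y, Z): chains whose image in K_n(Y)/K_n(Z)
   lies in im d_{n+1} *)
Definition relboundary (a b : Rg) (Y Z : set X) (n : nat) (c : chain n) : Prop :=
  exists (d : chain n.+1) (e : chain n),
    [/\ inK Y d, inK Z e & chain_eq c (chain_add (bd a b d) e)].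

(* i_* : H_n(Y', Z') -> H_n(Y, Z) induced by the inclusion (Y',Z') -> (Y,Z),
   (Y' ⊆ Y, Z' ⊆ Z), sends the class of c to the class of c (i o T = T).
   It is an isomorphism iff it is injective and surjective on classes. *)
Definition induced_iso (a b : Rg) (Y' Z' Y Z : set X) (n : nat) : Prop :=
  (forall c c' : chain n, relcycle a b Y' Z' c -> relcycle a b Y' Z' c' ->
     relboundary a b Y Z (chain_sub c c') ->
     relboundary a b Y' Z' (chain_sub c c')) /\
  (forall z : chain n, relcycle a b Y Z z ->
     exists c : chain n, relcycle a b Y' Z' c /\
       relboundary a b Y Z (chain_sub z c)).

End Cubical.

Definition NCD (Rg : comNzRingType) (a b : Rg) : Prop :=
  forall n : nat, exists x y : Rg, x * a ^+ n + y * b ^+ n = 1.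

(* Main.v *)
Require Import Defs.
From HB Require Import structures.
From mathcomp Require Import all_boot all_order all_algebra.
From mathcomp Require Import all_classical all_reals all_analysis.
From mathcomp Require Import ring lra.
Set Implicit Arguments. Unset Strict Implicit. Unset Printing Implicit Defensive.
Import Order.TTheory GRing.Theory Num.Theory.
Import numFieldNormedType.Exports.
Local Open Scope classical_set_scope.
Local Open Scope ring_scope.

(* A cube [T] is subdivided by precomposing with the [n]-th tensor power of the
   formal sum [t/2 + (1+t)/2 - 1/2] of self-maps of the interval, which has boundary
   [a 0 + b 1] for every choice of [a] and [b].  Four explicit maps of the square
   to the interval show that [a (id - sd1)] and [b (id - sd1)] are boundaries, so
   [x a + y b = 1] makes [sd1], and then by the Leibniz rule every tensor power,
   chain homotopic to the identity.  All these operators are precompositions, hence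
   natural, and a Lebesgue number of the open cover by the complement of [closure B]
   and the interior of [A] shows that iterated subdivision makes chains small. *)

(** * Formal sums *)

Section FormalSums.
Variable Rg : comNzRingType.

(** Formal sums are compared only by pairing them with an arbitrary [F], so identities between
    operators become ring identities and lists never need normalising; [chain_eqP] recovers equality
    of chains from this. *)
Definition fsum (S : Type) (c : seq (Rg * S)) (F : S -> Rg) : Rg :=
  \sum_(p <- c) p.1 * F p.2.

Lemma fsum_nil (S : Type) (F : S -> Rg) : fsum [::] F = 0.
Proof. by rewrite /fsum big_nil. Qed.

Lemma fsum_cons (S : Type) p (c : seq (Rg * S)) F :
  fsum (p :: c) F = p.1 * F p.2 + fsum c F.
Proof. by rewrite /fsum big_cons. Qed.

Lemma fsum_cat (S : Type) (c d : seq (Rg * S)) F :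
  fsum (c ++ d) F = fsum c F + fsum d F.
Proof. by rewrite /fsum big_cat. Qed.

Lemma eq_fsum (S : Type) (c : seq (Rg * S)) (F G : S -> Rg) :
  F =1 G -> fsum c F = fsum c G.
Proof. by move=> FG; apply: eq_bigr => p _; rewrite FG. Qed.

Lemma fsumD (S : Type) (c : seq (Rg * S)) F G :
  fsum c (fun s => F s + G s) = fsum c F + fsum c G.
Proof. by rewrite /fsum -big_split; apply: eq_bigr => p _; rewrite mulrDr. Qed.

Lemma fsumN (S : Type) (c : seq (Rg * S)) F :
  fsum c (fun s => - F s) = - fsum c F.
Proof. by rewrite /fsum -sumrN; apply: eq_bigr => p _; rewrite mulrN. Qed.

Lemma fsumZ (S : Type) (c : seq (Rg * S)) r F :
  fsum c (fun s => r * F s) = r * fsum c F.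
Proof. by rewrite /fsum mulr_sumr; apply: eq_bigr => p _; rewrite mulrCA. Qed.

Lemma fsum_sum (S : Type) (c : seq (Rg * S)) (I : Type) (r : seq I) F :
  fsum c (fun s => \sum_(i <- r) F i s) = \sum_(i <- r) fsum c (F i).
Proof.
by rewrite /fsum exchange_big; apply: eq_bigr => p _; rewrite mulr_sumr.
Qed.

Lemma fsumC (S S' : Type) (c : seq (Rg * S)) (d : seq (Rg * S')) F :
  fsum c (fun s => fsum d (F s)) = fsum d (fun t => fsum c (F^~ t)).
Proof. by rewrite {2}/fsum fsum_sum; apply: eq_bigr => q _; rewrite fsumZ. Qed.

Definition fimage (S S' : Type) (r : Rg) (f : S -> S') (c : seq (Rg * S)) :
  seq (Rg * S') := [seq (r * p.1, f p.2) | p <- c].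

Lemma fsum_fimage (S S' : Type) r (f : S -> S') c F :
  fsum (fimage r f c) F = r * fsum c (F \o f).
Proof.
by rewrite /fsum big_map mulr_sumr; apply: eq_bigr => p _; rewrite mulrA.
Qed.

Definition fimage2 (S S' S'' : Type) (r : Rg) (f : S -> S' -> S'')
  (c : seq (Rg * S)) (d : seq (Rg * S')) : seq (Rg * S'') :=
  [seq (r * (p.1 * q.1), f p.2 q.2) | p <- c, q <- d].

Lemma fsum_fimage2 (S S' S'' : Type) r (f : S -> S' -> S'') c d F :
  fsum (fimage2 r f c d) F = r * fsum c (fun s => fsum d (F \o f s)).
Proof.
rewrite /fsum /fimage2 big_allpairs_dep /= mulr_sumr; apply: eq_bigr => p _.
by rewrite !mulr_sumr; apply: eq_bigr => q _; rewrite !mulrA.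
Qed.

End FormalSums.

(** * Cubical subdivision and its homotopy, as formal sums of maps of cubes *)

Section Models.
Variables (R : realType) (Rg : comNzRingType).

Definition hd n (x : 'rV[R]_n.+1) : R := x ord0 ord0.
Definition tl n (x : 'rV[R]_n.+1) : 'rV[R]_n := \row_i x ord0 (lift ord0 i).
Local Notation cns := (ins ord0).

Lemma ins_same n (j : 'I_n.+1) (v : R) x : ins j v x ord0 j = v.
Proof. by rewrite mxE unlift_none. Qed.

Lemma ins_lift n (j : 'I_n.+1) (v : R) x i : ins j v x ord0 (lift j i) = x ord0 i.
Proof. by rewrite mxE liftK. Qed.

Lemma hd_cns n (t : R) (x : 'rV[R]_n) : hd (cns t x) = t.
Proof. exact: ins_same. Qed.

Lemma tl_cns n (t : R) (x : 'rV[R]_n) : tl (cns t x) = x.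
Proof. by apply/rowP => i; rewrite mxE ins_lift. Qed.

Lemma cns_hd_tl n (x : 'rV[R]_n.+1) : cns (hd x) (tl x) = x.
Proof.
apply/rowP => i; case: (unliftP ord0 i) => [k|] ->.
  by rewrite ins_lift mxE.
by rewrite ins_same.
Qed.

(** Splitting off the first coordinate turns every later face inclusion into [tens id] of a lower
    one, which makes the recursion for [bdm] possible. *)
Lemma ins_cns n (j : 'I_n.+1) (v : R) x :
  ins (lift ord0 j) v x = cns (hd x) (ins j v (tl x)).
Proof.
apply/rowP => i; case: (unliftP (lift ord0 j) i) => [k|] ->; last first.
  by rewrite ins_same ins_lift ins_same.
rewrite ins_lift; case: (unliftP ord0 k) => [l|] ->; last first.
  have -> : lift (lift ord0 j) ord0 = ord0 by exact/val_inj.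
  by rewrite ins_same.
have -> : lift (lift ord0 j) (lift ord0 l) = lift ord0 (lift j l).
  by apply/val_inj; rewrite /= /bump /= !add1n ltnS addnS.
by rewrite !ins_lift mxE.
Qed.

Definition tens n m (f : R -> R) (g : 'rV[R]_n -> 'rV[R]_m)
  (x : 'rV[R]_n.+1) : 'rV[R]_m.+1 := cns (f (hd x)) (g (tl x)).

(** The first coordinate is the homotopy parameter and the second runs along the interval being
    subdivided; together they yield one coordinate. *)
Definition tens2 n m (f : R -> R -> R) (g : 'rV[R]_n -> 'rV[R]_m)
  (x : 'rV[R]_n.+2) : 'rV[R]_m.+1 := cns (f (hd x) (hd (tl x))) (g (tl (tl x))).

(* The chain map of the interval: [0,1] is replaced by its two halves minus the
   constant path at the midpoint, which cancels the term [a + b] produced there. *)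
Definition sd1 : seq (Rg * (R -> R)) :=
  [:: (1, fun t => t / 2); (1, fun t => (1 + t) / 2); (-1, fun=> 1 / 2)].

Fixpoint sd n : seq (Rg * ('rV[R]_n -> 'rV[R]_n)) :=
  if n is m.+1 then fimage2 1 (@tens m m) sd1 (sd m) else [:: (1, id)].

Section Boundary.
Variables a b : Rg.

Definition ends : seq (Rg * R) := [:: (a, 0); (b, 1)].

(** The boundary as a formal sum of face inclusions, in Leibniz form: ends tensor identity, minus
    identity tensor the lower boundary. *)
Fixpoint bdm n : seq (Rg * ('rV[R]_n -> 'rV[R]_n.+1)) :=
  fimage 1 (fun v => cns v) ends ++
  (if n is m.+1 return seq (Rg * ('rV[R]_n -> 'rV[R]_n.+1))
   then fimage (-1) (tens id) (bdm m) else [::]).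

Lemma fsum_bdm0 (F : ('rV[R]_0 -> 'rV[R]_1) -> Rg) :
  fsum (bdm 0) F = fsum ends (fun v => F (cns v)).
Proof. by rewrite /bdm cats0 fsum_fimage mul1r. Qed.

Lemma fsum_bdmS n (F : ('rV[R]_n.+1 -> 'rV[R]_n.+2) -> Rg) :
  fsum (bdm n.+1) F = fsum ends (fun v => F (cns v))
                      - fsum (bdm n) (fun g => F (tens id g)).
Proof.
have -> : bdm n.+1 = fimage 1 (fun v => cns v) ends ++ fimage (-1) (tens id) (bdm n).
  by [].
by rewrite fsum_cat !fsum_fimage mul1r mulN1r.
Qed.

Lemma fsum_bdmE n (F : ('rV[R]_n -> 'rV[R]_n.+1) -> Rg) :
  fsum (bdm n) F =
  \sum_(j < n.+1) (-1) ^+ j * (a * F (ins j 0) + b * F (ins j 1)).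
Proof.
elim: n F => [|n IH] F.
  by rewrite fsum_bdm0 !fsum_cons !fsum_nil big_ord_recl big_ord0 expr0 mul1r !addr0.
rewrite fsum_bdmS IH [RHS]big_ord_recl /= !fsum_cons fsum_nil expr0 mul1r addr0.
congr (_ + _); rewrite -sumrN; apply: eq_bigr => j _.
rewrite /bump /= add1n exprS mulN1r mulNr; congr (- (_ * (_ * F _ + _ * F _)));
  by apply/funext => x; rewrite ins_cns.
Qed.

Lemma fsum_sdS n (F : ('rV[R]_n.+1 -> 'rV[R]_n.+1) -> Rg) :
  fsum (sd n.+1) F = fsum sd1 (fun f => fsum (sd n) (fun g => F (tens f g))).
Proof.
have -> : sd n.+1 = fimage2 1 (@tens n n) sd1 (sd n) by [].
by rewrite fsum_fimage2 mul1r.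
Qed.

Lemma sd1_ends (F : R -> Rg) :
  fsum sd1 (fun f => fsum ends (fun v => F (f v))) = fsum ends F.
Proof.
rewrite !fsum_cons !fsum_nil /=.
have -> : 0 / 2 = 0 :> R by field.
have -> : (1 + 0) / 2 = 1 / 2 :> R by field.
have -> : (1 + 1) / 2 = 1 :> R by field.
ring.
Qed.

Lemma tens_cns n m f (g : 'rV[R]_n -> 'rV[R]_m) v :
  tens f g \o cns v = cns (f v) \o g.
Proof. by apply/funext => x; rewrite /tens /= hd_cns tl_cns. Qed.

Lemma tens_comp n m k f f' (g : 'rV[R]_n -> 'rV[R]_m) (g' : 'rV[R]_k -> 'rV[R]_n) :
  tens f g \o tens f' g' = tens (f \o f') (g \o g').
Proof. by apply/funext => x; rewrite /tens /= hd_cns tl_cns. Qed.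

Lemma tens2_cns n m f (g : 'rV[R]_n -> 'rV[R]_m) v :
  tens2 f g \o cns v = tens (f v) g.
Proof. by apply/funext => x; rewrite /tens /tens2 /= hd_cns tl_cns. Qed.

Lemma tens2_tens_cns n m f (g : 'rV[R]_n -> 'rV[R]_m) v :
  tens2 f g \o tens id (cns v) = tens (f^~ v) g.
Proof. by apply/funext => x; rewrite /tens /tens2 /= !(hd_cns, tl_cns). Qed.

Lemma tens2_tens_tens n m k f (g : 'rV[R]_n -> 'rV[R]_m) (g' : 'rV[R]_k -> 'rV[R]_n) :
  tens2 f g \o tens id (tens id g') = tens2 f (g \o g').
Proof. by apply/funext => x; rewrite /tens /tens2 /= !(hd_cns, tl_cns). Qed.

Lemma tens_tens2 n m k f (g : 'rV[R]_n -> 'rV[R]_m) (g' : 'rV[R]_k -> 'rV[R]_n) :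
  tens id g \o tens2 f g' = tens2 f (g \o g').
Proof. by apply/funext => x; rewrite /tens /tens2 /= !(hd_cns, tl_cns). Qed.

Lemma tens_id n : tens id (@id 'rV[R]_n) = id.
Proof. by apply/funext => x; rewrite /tens cns_hd_tl. Qed.

Lemma fsum_sd_ends n (F : ('rV[R]_n -> 'rV[R]_n.+1) -> Rg) :
  fsum (sd n.+1) (fun s => fsum ends (fun v => F (s \o cns v))) =
  fsum ends (fun v => fsum (sd n) (fun s => F (cns v \o s))).
Proof.
rewrite fsum_sdS -sd1_ends; apply: eq_fsum => f.
rewrite fsumC; apply: eq_fsum => v; apply: eq_fsum => g.
by rewrite tens_cns.
Qed.

(** Subdivision is a chain map: the faces in the first direction match by [sd1_ends], the remaining
    ones by induction on the tensor factor. *)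
Lemma sd_bdm n (F : ('rV[R]_n -> 'rV[R]_n.+1) -> Rg) :
  fsum (sd n.+1) (fun s => fsum (bdm n) (fun d => F (s \o d))) =
  fsum (bdm n) (fun d => fsum (sd n) (fun s => F (d \o s))).
Proof.
elim: n F => [|n IH] F.
  rewrite fsum_bdm0 -fsum_sd_ends; apply: eq_fsum => s; exact: fsum_bdm0.
rewrite fsum_bdmS -fsum_sd_ends.
under eq_fsum do rewrite fsum_bdmS.
rewrite fsumD fsumN; congr (_ - _).
rewrite fsum_sdS.
under [RHS]eq_fsum do rewrite fsum_sdS.
rewrite [RHS]fsumC; apply: eq_fsum => f.
have -> : fsum (bdm n) (fun t => fsum (sd n) (fun g => F (tens id t \o tens f g))) =
   fsum (bdm n) (fun d => fsum (sd n) (fun s => F (tens f (d \o s)))).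
  by apply: eq_fsum => d; apply: eq_fsum => s; rewrite tens_comp.
rewrite -(IH (fun g => F (tens f g))).
by apply: eq_fsum => d; apply: eq_fsum => s; rewrite tens_comp.
Qed.

Variables x y : Rg.
Hypothesis xayb : x * a + y * b = 1.

(* The first two maps bound [b] times, and the last two [a] times, the
   difference [id - sd1]; coprimality of [a] and [b] then divides it out. *)
Definition hm1 : seq (Rg * (R -> R -> R)) :=
  [:: (- y, fun u s => s * (1 + u) / 2); (y, fun u s => s / 2);
      (- x, fun u s => (1 - u) * s + u * ((1 + s) / 2));
      (x, fun u s => (1 + s) / 2)].

(** The usual homotopy for a tensor product: [hm1] tensor identity, minus [sd1] tensor the lower
    homotopy. It starts empty because [sd 0] is the identity. *)
Fixpoint hm n : seq (Rg * ('rV[R]_n.+1 -> 'rV[R]_n)) :=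
  if n is m.+1 return seq (Rg * ('rV[R]_n.+1 -> 'rV[R]_n)) then
    fimage 1 (fun f => tens2 f id) hm1 ++
    fimage2 (-1) (@tens m.+1 m) sd1 (hm m)
  else [::].

Lemma fsum_hmS n (F : ('rV[R]_n.+2 -> 'rV[R]_n.+1) -> Rg) :
  fsum (hm n.+1) F = fsum hm1 (fun f => F (tens2 f id)) -
                     fsum sd1 (fun f => fsum (hm n) (fun g => F (tens f g))).
Proof.
have -> : hm n.+1 = fimage 1 (fun f => tens2 f id) hm1 ++
                    fimage2 (-1) (@tens n.+1 n) sd1 (hm n) by [].
by rewrite fsum_cat fsum_fimage fsum_fimage2 mul1r mulN1r.
Qed.

Lemma hm1_boundary (F : (R -> R) -> Rg) :
  fsum hm1 (fun f => fsum ends (fun v => F (f v)) - fsum ends (fun v => F (f^~ v)))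
  = fsum sd1 F - F id.
Proof.
rewrite !fsum_cons !fsum_nil /=.
(* The faces of the four squares are put in normal form, so that equal maps become equal arguments
   of [F]. *)
have e1 : (fun s : R => s * (1 + 0) / 2) = fun s => s / 2.
  by apply/funext => s; field.
have e2 : (fun s : R => s * (1 + 1) / 2) = id by apply/funext => s /=; field.
have e3 : (fun s : R => 1 * (1 + s) / 2) = fun s => (1 + s) / 2.
  by apply/funext => s; field.
have e4 : (fun s : R => 0 * (1 + s) / 2) = fun=> 0 by apply/funext => s; field.
have e5 : (fun s : R => (1 - 0) * s + 0 * ((1 + s) / 2)) = id.
  by apply/funext => s /=; field.
have e6 : (fun s : R => (1 - 1) * s + 1 * ((1 + s) / 2)) = fun s => (1 + s) / 2.
  by apply/funext => s /=; field.
have e7 : (fun s : R => (1 - s) * 0 + s * ((1 + 0) / 2)) = fun s => s / 2.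
  by apply/funext => s /=; field.
have e8 : (fun s : R => (1 - s) * 1 + s * ((1 + 1) / 2)) = fun=> 1.
  by apply/funext => s /=; field.
have e9 : (fun=> (1 + 0) / 2 : R) = (fun=> 1 / 2) :> (R -> R).
  by apply/funext => s /=; field.
have e10 : (fun=> (1 + 1) / 2 : R) = (fun=> 1) :> (R -> R).
  by apply/funext => s /=; field.
have e11 : (fun=> 0 / 2 : R) = (fun=> 0) :> (R -> R).
  by apply/funext => s /=; field.
rewrite e1 e2 e3 e4 e5 e6 e7 e8 e9 e10 e11.
set f1 := F _; set f2 := F id; set f3 := F _; set f4 := F _; set f5 := F _.
set f6 := F _.
(* In each pair the square constant in its first variable removes the faces with the wrong
   coefficient. The constant maps at 0 and 1 ([f3], [f6]) cancel, and [x * a + y * b] factors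
   out. *)
transitivity ((x * a + y * b) * (f1 + f4 - f5 - f2)); first by ring.
by rewrite xayb; ring.
Qed.

Lemma hm_bdm0 (F : ('rV[R]_1 -> 'rV[R]_1) -> Rg) :
  fsum (hm 1) (fun h => fsum (bdm 1) (fun d => F (h \o d))) =
  fsum (sd 1) F - F id.
Proof.
rewrite fsum_hmS -(tens_id 0).
have -> : fsum (sd 1) F = fsum sd1 (fun f => F (tens f id)).
  by rewrite fsum_sdS; apply: eq_fsum => f; rewrite /= fsum_cons fsum_nil mul1r addr0.
rewrite -(hm1_boundary (fun f => F (tens f id))).
have -> : fsum sd1 (fun f : R -> R => fsum (hm 0) (fun g =>
  fsum (bdm 1) (fun d => F (tens f g \o d)))) = 0.
  by rewrite /fsum big1 // => p _; rewrite big_nil mulr0.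
rewrite subr0; apply: eq_fsum => f; rewrite fsum_bdmS fsum_bdm0.
by congr (_ - _); apply: eq_fsum => v; rewrite ?tens2_cns ?tens2_tens_cns.
Qed.

(** The chain homotopy identity $\partial H + H\partial = \mathrm{sd} - \mathrm{id}$ at the level of
    maps of cubes; precomposition reverses the order of the factors. *)
Lemma hm_bdm n (F : ('rV[R]_n.+1 -> 'rV[R]_n.+1) -> Rg) :
  fsum (hm n.+1) (fun h => fsum (bdm n.+1) (fun d => F (h \o d))) +
  fsum (bdm n) (fun d => fsum (hm n) (fun h => F (d \o h))) =
  fsum (sd n.+1) F - F id.
Proof.
elim: n F => [|n IH] F.
  rewrite hm_bdm0 [X in _ + X](_ : _ = 0) ?addr0 //.
  by rewrite /fsum big1 // => p _; rewrite big_nil mulr0.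
(* The mixed terms [hB] and [eH] each occur twice with opposite signs and cancel. The terms [HB] and
   [BH] combine by the induction hypothesis under each map of [sd1]. *)
pose HB f := fsum (hm n.+1) (fun h => fsum (bdm n.+1) (fun d => F (tens f (h \o d)))).
pose BH f := fsum (bdm n) (fun d => fsum (hm n) (fun h => F (tens f (d \o h)))).
pose hB := fsum hm1 (fun f => fsum (bdm n) (fun d => F (tens2 f d))).
pose eH := fsum ends (fun v => fsum (hm n.+1) (fun h => F (cns v \o h))).
have T1 : fsum hm1 (fun f => fsum (bdm n.+2) (fun d => F (tens2 f id \o d))) =
    fsum sd1 (fun f => F (tens f id)) - F id + hB.
  rewrite -(tens_id n.+1) -(hm1_boundary (fun f => F (tens f id))) -fsumD.
  apply: eq_fsum => f; rewrite !fsum_bdmS opprB addrA addrAC; congr (_ - _ + _).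
  - by apply: eq_fsum => v; rewrite tens2_cns.
  - by apply: eq_fsum => v; rewrite tens2_tens_cns.
  - by apply: eq_fsum => v; rewrite tens2_tens_tens.
have T2 : fsum sd1 (fun f => fsum (hm n.+1) (fun g =>
      fsum (bdm n.+2) (fun d => F (tens f g \o d)))) = eH - fsum sd1 HB.
  rewrite -fsumN /eH -(sd1_ends (fun v => fsum (hm n.+1) (fun h => F (cns v \o h)))).
  rewrite -fsumD; apply: eq_fsum => f; rewrite (fsumC ends) /HB -fsumN -fsumD.
  apply: eq_fsum => g; rewrite fsum_bdmS; congr (_ - _).
    by apply: eq_fsum => v; rewrite tens_cns.
  by apply: eq_fsum => d; rewrite tens_comp.
have T3 : fsum (bdm n.+1) (fun d => fsum (hm n.+1) (fun h => F (d \o h))) =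
    eH - (hB - fsum sd1 BH).
  rewrite fsum_bdmS; congr (_ - _).
  under eq_fsum do rewrite fsum_hmS.
  rewrite fsumD fsumN; congr (_ - _).
    rewrite fsumC; apply: eq_fsum => f; apply: eq_fsum => d.
    by rewrite tens_tens2.
  rewrite fsumC; apply: eq_fsum => f; apply: eq_fsum => d; apply: eq_fsum => h.
  by rewrite tens_comp.
rewrite fsum_hmS T1 T2 T3.
have T4 : fsum sd1 HB + fsum sd1 BH =
  fsum (sd n.+2) F - fsum sd1 (fun f => F (tens f id)).
  rewrite -fsumD [in RHS]fsum_sdS -fsumN -fsumD; apply: eq_fsum => f.
  exact: (IH (fun g => F (tens f g))).
transitivity (fsum sd1 (fun f => F (tens f id)) - F id +
  (fsum sd1 HB + fsum sd1 BH)); first by ring.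
by rewrite T4; ring.
Qed.

End Boundary.
End Models.

(** * Predicates on the terms of a formal sum *)

Section Support.
Variable Rg : comNzRingType.

(** A condition on list entries, including those whose coefficients cancel; it passes easily through
    images, and [inKP] relates it to coefficients. *)
Definition supported (S : Type) (P : S -> Prop) (c : seq (Rg * S)) : bool :=
  all (fun p => `[< P p.2 >]) c.

Lemma supported_cons (S : Type) (P : S -> Prop) p (c : seq (Rg * S)) :
  supported P (p :: c) <-> P p.2 /\ supported P c.
Proof. by split=> [/= /andP[/asboolP]|[/asboolP Pp Pc]] //=; apply/andP. Qed.

Lemma supported_cat (S : Type) (P : S -> Prop) (c d : seq (Rg * S)) :
  supported P c -> supported P d -> supported P (c ++ d).
Proof. by rewrite /supported all_cat => -> ->. Qed.

Lemma sub_supported (S : Type) (P Q : S -> Prop) (c : seq (Rg * S)) :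
  (forall s, P s -> Q s) -> supported P c -> supported Q c.
Proof. by move=> PQ; apply: sub_all => p /asboolP /PQ /asboolP. Qed.

Lemma supported_fimage (S S' : Type) (P : S -> Prop) (Q : S' -> Prop) r f
    (c : seq (Rg * S)) :
  (forall s, P s -> Q (f s)) -> supported P c -> supported Q (fimage r f c).
Proof.
move=> PQ; rewrite /supported all_map; apply: sub_all => p /asboolP /PQ.
by move=> /asboolP.
Qed.

Lemma supported_fimage2 (S S' S'' : Type) (P : S -> Prop) (Q : S' -> Prop)
    (W : S'' -> Prop) r f (c : seq (Rg * S)) (d : seq (Rg * S')) :
  (forall s t, P s -> Q t -> W (f s t)) ->
  supported P c -> supported Q d -> supported W (fimage2 r f c d).
Proof.
move=> PQW + Qd; elim: c => [//|p c IH] /supported_cons[Pp Pc].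
rewrite /fimage2 allpairs_cons; apply: supported_cat; last exact: IH.
rewrite /supported all_map; apply: sub_all Qd => q /asboolP Qq.
by apply/asboolP; exact: PQW.
Qed.

Lemma eq_fsum_supported (S : Type) (P : S -> Prop) (c : seq (Rg * S)) F G :
  (forall s, P s -> F s = G s) -> supported P c -> fsum c F = fsum c G.
Proof.
move=> FG; elim: c => [|p c IH]; first by rewrite !fsum_nil.
by move=> /supported_cons[Pp Pc]; rewrite !fsum_cons FG // IH.
Qed.

End Support.

(** * Lipschitz maps of cubes *)

Section Lipschitz.
Variable R : realType.

Definition rclose n (e : R) (x y : 'rV[R]_n) :=
  forall i, `|x ord0 i - y ord0 i| <= e.

(** Distances are compared only inside the cube: some homotopy maps are quadratic and have no global
    Lipschitz constant. *)
Definition cubelip (K : R) m n (f : 'rV[R]_m -> 'rV[R]_n) :=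
  (forall x, cube x -> cube (f x)) /\
  (forall x y e, 0 <= e -> cube x -> cube y -> rclose e x y -> rclose (K * e) (f x) (f y)).

Lemma clamp_cube n (x : 'rV[R]_n) : cube (clamp x).
Proof.
by move=> i; rewrite mxE le_min ler01 le_max lexx /= ge_min lexx.
Qed.

Lemma clamp_id n (x : 'rV[R]_n) : cube x -> clamp x = x.
Proof.
move=> cx; apply/rowP => i; rewrite mxE; have /andP[x0 x1] := cx i.
by rewrite max_r // min_r.
Qed.

Lemma rclose_clamp n e (x y : 'rV[R]_n) : rclose e x y -> rclose e (clamp x) (clamp y).
Proof.
move=> xy i; rewrite !mxE; have := xy i.
move: (x ord0 i) (y ord0 i) => s t; rewrite !ler_norml.
have [] := leP 0 s; have [] := leP 0 t => ? ?.
- by have [] := leP 1 s; have [] := leP 1 t; lra.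
- by have [] := leP 1 s; have [] := leP 1 0; lra.
- by have [] := leP 1 t; have [] := leP 1 0; lra.
- by lra.
Qed.

Lemma clamp_ins n (j : 'I_n.+1) (i : bool) (x : 'rV[R]_n) :
  clamp (ins j (if i then 1 else 0) x) = ins j (if i then 1 else 0) (clamp x).
Proof.
apply/rowP => k; rewrite mxE; case: (unliftP j k) => [l|] ->.
  by rewrite !ins_lift mxE.
by rewrite !ins_same; case: i; rewrite ?maxxx ?(max_r ler01) ?minxx ?(min_r ler01).
Qed.

Lemma cubelip_ins n (j : 'I_n.+1) (i : bool) :
  cubelip 1 (fun x : 'rV[R]_n => ins j (if i then 1 else 0) x).
Proof.
split=> [x cx k|x y e e0 cx cy xy k].
  case: (unliftP j k) => [l|] ->; first by rewrite ins_lift.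
  by rewrite ins_same; case: i; rewrite ?lexx ?ler01.
case: (unliftP j k) => [l|] ->; first by rewrite !ins_lift mul1r.
by rewrite !ins_same subrr normr0 mul1r.
Qed.

Lemma cube_cns n t (x : 'rV[R]_n) : 0 <= t <= 1 -> cube x -> cube (ins ord0 t x).
Proof.
move=> t01 cx i; case: (unliftP ord0 i) => [l|] ->; first by rewrite ins_lift.
by rewrite ins_same.
Qed.

Lemma rclose_cns n e s t (x y : 'rV[R]_n) : `|s - t| <= e -> rclose e x y ->
  rclose e (ins ord0 s x) (ins ord0 t y).
Proof.
move=> st xy i; case: (unliftP ord0 i) => [l|] ->; first by rewrite !ins_lift.
by rewrite !ins_same.
Qed.

Lemma cube_tl n (x : 'rV[R]_n.+1) : cube x -> cube (tl x).
Proof. by move=> cx i; rewrite mxE. Qed.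

Lemma rclose_tl n e (x y : 'rV[R]_n.+1) : rclose e x y -> rclose e (tl x) (tl y).
Proof. by move=> xy i; rewrite !mxE. Qed.

Lemma cubelip_tens m n K f (g : 'rV[R]_m -> 'rV[R]_n) :
  (forall t, 0 <= t <= 1 -> 0 <= f t <= 1) ->
  (forall s t, `|f s - f t| <= K * `|s - t|) -> 0 <= K ->
  cubelip K g -> cubelip K (tens f g).
Proof.
move=> f01 fK K0 [gc gK]; split=> [x cx|x y e e0 cx cy xy].
  by apply: cube_cns; [exact/f01/cx|exact/gc/cube_tl].
apply: rclose_cns; last by apply: gK => //; [exact: cube_tl..|exact: rclose_tl].
by rewrite (le_trans (fK _ _))// ler_wpM2l//; exact: xy.
Qed.

Lemma cubelip_tens2 n K f :
  (forall s t, 0 <= s <= 1 -> 0 <= t <= 1 -> 0 <= f s t <= 1) ->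
  (forall s t s' t' e, 0 <= s <= 1 -> 0 <= t <= 1 -> 0 <= s' <= 1 -> 0 <= t' <= 1 ->
     `|s - s'| <= e -> `|t - t'| <= e -> `|f s t - f s' t'| <= K * e) ->
  1 <= K -> cubelip K (tens2 f (@id 'rV[R]_n)).
Proof.
move=> f01 fK K1; split=> [x cx|x y e e0 cx cy xy].
  by apply: cube_cns; [apply: f01; [exact: cx|exact: (cube_tl cx)]|exact/cube_tl/cube_tl].
(* The trailing coordinates pass through unchanged, which is why [K] has to be at least 1. *)
apply: rclose_cns; last first.
  move=> i; apply: le_trans (rclose_tl (rclose_tl xy) i) _.
  by rewrite ler_peMl.
by apply: fK; [exact: cx|exact: (cube_tl cx)|exact: cy|exact: (cube_tl cy)|
  exact: xy|exact: (rclose_tl xy)].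
Qed.

Lemma rclose_of_ball n (x y : 'rV[R]_n) e : ball x e y -> rclose e x y.
Proof. by case=> _ xy i; exact/ltW/xy. Qed.

Lemma ball_of_rclose n (x y : 'rV[R]_n) e d : 0 <= e -> e < d -> rclose e x y -> ball x d y.
Proof.
move=> e0 ed xy; split; first exact: le_lt_trans e0 ed.
by move=> i j; rewrite ord1; exact: le_lt_trans (xy j) ed.
Qed.

Lemma cube_compact n : compact (@cube R n).
Proof.
have := @rV_compact R n (fun=> `[0, 1]%classic) (fun=> @segment_compact R 0 1).
congr compact; apply/seteqP; split=> x /= H i; have := H i; by rewrite in_itv.
Qed.

Variable Rg : comNzRingType.

Lemma sd1_lip : supported (fun f : R -> R =>
  (forall t, 0 <= t <= 1 -> 0 <= f t <= 1) /\
  (forall s t, `|f s - f t| <= 1/2 * `|s - t|)) (sd1 R Rg).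
Proof.
have h2 (s t : R) : `|s / 2 - t / 2| = 1/2 * `|s - t|.
  by rewrite -mulrBl normrM [X in _ * X]gtr0_norm ?invr_gt0// mulrC div1r.
do 3?[apply/supported_cons; split; [split=> /= [t|s t]; [lra|]|]] => //.
- by rewrite h2.
- by rewrite h2 opprD addrACA subrr add0r.
- by rewrite subrr normr0 mulr_ge0.
Qed.

Lemma sd_cubelip n : supported (@cubelip (1/2) n n) (sd R Rg n).
Proof.
elim: n => [|n IH].
  (* In dimension 0 [rclose] is vacuous, so even the identity has constant 1/2. *)
  by apply/supported_cons; split=> //; split=> // x y e _ _ _ _ [].
apply: supported_fimage2 sd1_lip IH => f g [f01 fK] gK.
exact: cubelip_tens.
Qed.

(** On the unit square the absolute partial derivatives of each map add up to at most 3/2. The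
    constant 2 serves only to make the homotopy preserve singular cubes. *)
Lemma hm1_lip (x y : Rg) : supported (fun f : R -> R -> R =>
    (forall s t, 0 <= s <= 1 -> 0 <= t <= 1 -> 0 <= f s t <= 1) /\
    (forall s t s' t' e, 0 <= s <= 1 -> 0 <= t <= 1 -> 0 <= s' <= 1 ->
     0 <= t' <= 1 -> `|s - s'| <= e -> `|t - t'| <= e ->
     `|f s t - f s' t'| <= 2 * e)) (hm1 R x y).
Proof.
do 4?[apply/supported_cons; split; [split=> /= [s t|s t s' t' e]; rewrite ?ler_norml|]] => //.
all: nra.
Qed.

Lemma hm_cubelip (x y : Rg) n : supported (@cubelip 2 n.+1 n) (hm R x y n).
Proof.
elim: n => [//|n IH]; apply: supported_cat.
  apply: supported_fimage (hm1_lip x y) => f [f01 fK].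
  by apply: cubelip_tens2 => //; lra.
apply: supported_fimage2 sd1_lip IH => f g [f01 fK] gK.
apply: cubelip_tens => // s t; apply: le_trans (fK s t) _.
by rewrite ler_wpM2r//; lra.
Qed.

End Lipschitz.

(** * Singular cubes *)

Section Cubes.
Variables (R : realType) (X : topologicalType).

(** Clamp invariance extends continuity on the cube to every point of the ambient space. *)
Lemma is_cube_near n Y (T : 'rV[R]_n -> X) x (V : set X) :
  is_cube Y T -> nbhs (T x) V ->
  exists2 e : R, 0 < e & forall y, rclose e x y -> V (T y).
Proof.
case=> /subspace_continuousP cT Tc _; rewrite Tc => /(cT _ (clamp_cube x)).
move=> /= /nbhs_ballP[e /= e0 eV].
exists (e / 2); first by rewrite divr_gt0.
move=> y xy; rewrite Tc; apply: eV; last exact: clamp_cube.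
by apply: (@ball_of_rclose _ _ _ _ (e / 2)); [lra|lra|exact: rclose_clamp].
Qed.

(** The final [clamp] restores the canonical representative, since [f] is controlled only on the
    cube. *)
Lemma is_cube_comp m n Y (T : 'rV[R]_n -> X) K (f : 'rV[R]_m -> 'rV[R]_n) :
  0 < K -> is_cube Y T -> cubelip K f -> is_cube Y (T \o f \o @clamp R m).
Proof.
move=> K0 cT [fc fK]; split=> [|x|x] /=; last first.
- by case: cT.
- by rewrite (clamp_id (clamp_cube x)).
apply: continuous_subspaceT => x V /= /(is_cube_near cT)[e e0 eV].
apply/nbhs_ballP; exists (e / K) => /=; first by rewrite divr_gt0.
move=> y /rclose_of_ball /rclose_clamp xy; apply: eV.
rewrite (_ : e = K * (e / K)); last by rewrite mulrC divfK// gt_eqF.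
by apply: fK => //; [rewrite divr_ge0// ltW|exact: clamp_cube..].
Qed.

Lemma is_cube_face m Y (T : 'rV[R]_m.+1 -> X) (j : 'I_m.+1) (i : bool) :
  is_cube Y T -> is_cube Y (face j i T).
Proof.
move=> cT; have -> : face j i T =
    T \o (fun x => ins j (if i then 1 else 0) x) \o @clamp R m.
  case: cT => _ Tc _; apply/funext => x; rewrite /face /= [LHS]Tc.
  by rewrite clamp_ins.
by apply: (@is_cube_comp _ _ _ _ 1) => //; exact: cubelip_ins.
Qed.

(** * Lebesgue numbers for the cover by the complement of [B] and [A] *)

Section Lebesgue.
Variables A B : set X.

Definition small_at n (d : R) (T : 'rV[R]_n -> X) (x : 'rV[R]_n) :=
  (forall y, cube y -> rclose d x y -> (~` B) (T y)) \/
  (forall y, cube y -> rclose d x y -> A (T y)).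

Definition lebesgue n (d : R) (T : 'rV[R]_n -> X) :=
  forall x, cube x -> small_at d T x.

Lemma lebesgue_le n d d' (T : 'rV[R]_n -> X) :
  d <= d' -> lebesgue d' T -> lebesgue d T.
Proof.
move=> dd' lT x cx; case: (lT x cx) => H; [left|right] => y cy xy;
  by apply: H => // i; exact: le_trans (xy i) dd'.
Qed.

(** Points of the cube at distance at most [2 * d] are sent to points at distance at most [d], so
    one subdivision doubles a Lebesgue number. *)
Lemma lebesgue_comp n d (T : 'rV[R]_n -> X) (f : 'rV[R]_n -> 'rV[R]_n) :
  0 <= d -> cubelip (1/2) f -> lebesgue d T ->
  lebesgue (2 * d) (T \o f \o @clamp R n).
Proof.
move=> d0 [fc fK] lT x cx.
by case: (lT (f x) (fc x cx)) => H; [left|right] => y cy xy;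
  rewrite /= (clamp_id cy); apply: H; [exact: fc|
    rewrite (_ : d = 1/2 * (2 * d)); [apply: fK => //; lra|lra]|
    exact: fc|
    rewrite (_ : d = 1/2 * (2 * d)); [apply: fK => //; lra|lra]].
Qed.

(** The cube has side 1, so a ball of radius 1 around any of its points already covers it. *)
Lemma lebesgue1 n d (T : 'rV[R]_n -> X) : 1 <= d -> is_cube setT T ->
  lebesgue d T -> is_cube (~` B) T \/ is_cube A T.
Proof.
move=> d1 [cT Tc _] lT.
have H x : rclose d (clamp (0 : 'rV[R]_n)) (clamp x).
  move=> i; have := clamp_cube (0 : 'rV[R]_n) i; have := clamp_cube x i.
  by rewrite ler_norml; lra.
by case: (lT _ (clamp_cube 0)) => L; [left|right]; split=> // x;
  rewrite Tc; apply: L => //; exact: clamp_cube.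
Qed.

Hypothesis BA : closure B `<=` interior A.

Lemma exists_lebesgue n (T : 'rV[R]_n -> X) : is_cube setT T ->
  exists2 d : R, 0 < d & lebesgue d T.
Proof.
move=> cT.
have loc x : exists2 e : R, 0 < e & small_at e T x.
  (* The closure hypothesis enters here: a point of [closure B] is interior to [A], and any other
     point has a neighbourhood missing [B]. *)
  have [/BA iA|/= ncB] := pselect (closure B (T x)).
    have [e e0 eA] := is_cube_near cT iA.
    by exists e => //; right=> y _ xy; exact: eA.
  have [V VT VB] : exists2 V, nbhs (T x) V & V `<=` ~` B.
    apply: contrapT => nV; apply: ncB => V VT.
    apply: contrapT => BV; apply: nV; exists V => // z Vz Bz.
    by apply: BV; exists z.
  have [e e0 eV] := is_cube_near cT VT.
  by exists e => //; left=> y _ xy; exact/VB/eV.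
have /compact_near_coveringP cc := @cube_compact R n.
have : \forall d \near 0^'+, @cube R n `<=` small_at d T.
  apply: cc => x cx; have [e e0 se] := loc x.
  (* Half of [e] allows for moving the centre from [x] to [y], the other half for the radius [d]. *)
  exists (ball x (e / 2), [set d | 0 < d <= e / 2]) => /=.
    split; first by apply: nbhsx_ballx; lra.
    by near=> d => /=; apply/andP; split; near: d;
      [exact: nbhs_right_gt|apply: nbhs_right_le; lra].
  move=> [y d] /= [/rclose_of_ball xy /andP[d0 de]].
  have xz z : rclose d y z -> rclose e x z.
    move=> yz i; have := xy i; have := yz i; rewrite !ler_norml; lra.
  by case: se => H; [left|right] => z cz /xz; exact: H.
move=> H; near (0 : R)^'+ => d; exists d; first by near: d; exact: nbhs_right_gt.
by near: d.
Unshelve. all: by end_near. Qed.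

End Lebesgue.
End Cubes.

(** * Chains *)

Section Chains.
Variables (R : realType) (Rg : comNzRingType) (X : topologicalType).
Local Notation chain := (chain R Rg X).

Lemma fsum_chain_sub n (c d : chain n) F :
  fsum (chain_sub c d) F = fsum c F - fsum d F.
Proof.
rewrite /chain_sub fsum_cat /fsum big_map -sumrN; congr (_ + _).
by apply: eq_bigr => p _; rewrite mulNr.
Qed.

Lemma coefE n (c : chain n) U :
  coef c U = fsum c (fun V => if pselect (V = U) then 1 else 0).
Proof. by apply: eq_bigr => p _; case: pselect => ? /=; rewrite ?mulr1 ?mulr0. Qed.

Lemma coef_filter n (c : chain n) (P : pred ('rV[R]_n -> X)) U :
  coef [seq p <- c | P p.2] U = if P U then coef c U else 0.
Proof.
rewrite /coef big_filter; case: ifPn => PU.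
  rewrite big_mkcond; apply: eq_bigr => p _; case: pselect => /= [->|?].
    by rewrite PU.
  by case: ifP.
by rewrite big1 // => p Pp; case: pselect => //= pU; rewrite pU (negbTE PU) in Pp.
Qed.

(** Strong induction on the length: all entries carrying the first map [U] are removed together,
    their total weight being [coef c U = 0]. *)
Lemma fsum_eq0 n (c : chain n) : (forall U, coef c U = 0) ->
  forall F, fsum c F = 0.
Proof.
have [k] := ubnP (size c); elim: k c => // k IH [|[r U] c] /= sc c0 F.
  exact: fsum_nil.
pose P V := ~~ `[< V = U >].
have split_c d : fsum d F = coef d U * F U + fsum [seq p <- d | P p.2] F.
  elim: d => [|p d IHd]; first by rewrite coefE !fsum_nil mul0r addr0.
  rewrite fsum_cons IHd (coefE (p :: d)) fsum_cons -coefE /= /P.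
  case: pselect => /= [e|ne].
    by rewrite e asboolT //= mulr1 mulrDl addrA.
  by rewrite asboolF //= fsum_cons mulr0 add0r addrCA.
rewrite split_c c0 mul0r add0r /= {1}/P asboolT //=.
apply: IH => [|V].
  by rewrite size_filter; apply: leq_ltn_trans (count_size _ _) _; rewrite -ltnS.
have := coef_filter ((r, U) :: c) P V; rewrite /= {1}/P asboolT //= => ->.
by rewrite c0 if_same.
Qed.

Lemma chain_eqP n (c d : chain n) :
  chain_eq c d <-> forall F, fsum c F = fsum d F.
Proof.
split=> [cd F|cd U]; last by rewrite !coefE cd.
apply/eqP; rewrite -subr_eq0 -fsum_chain_sub; apply/eqP/fsum_eq0 => U.
by rewrite coefE fsum_chain_sub -!coefE cd subrr.
Qed.

Lemma inK_chain_eq n Y (c d : chain n) : chain_eq c d -> inK Y d -> inK Y c.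
Proof. by move=> cd dY U; rewrite cd; exact: dY. Qed.

Lemma coef_supported n P (c : chain n) U : supported P c -> coef c U != 0 -> P U.
Proof.
move=> sc; apply: contra_neqP => nPU.
rewrite coefE (eq_fsum_supported (G := fun=> 0) _ sc) => [|V PV].
  by rewrite /fsum big1 // => p _; rewrite mulr0.
by case: pselect => //= VU; case: nPU; rewrite -VU.
Qed.

Lemma inKP n Y (c : chain n) :
  inK Y c <-> exists2 d, chain_eq c d & supported (is_cube Y) d.
Proof.
split=> [cY|[d cd dY] U]; last by rewrite cd => /(coef_supported dY).
(* Discarding the entries that are not cubes of [Y] changes nothing, as their total coefficients
   vanish. *)
exists [seq p <- c | `[< is_cube Y p.2 >]]; last exact: filter_all.
move=> U; rewrite (coef_filter c (fun V => `[< is_cube Y V >])).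
by case: asboolP => // nU; apply: contra_notP nU => /eqP; exact: cY.
Qed.

Lemma inK_nil n Y : inK Y ([::] : chain n).
Proof. by apply/inKP; exists [::]. Qed.

Lemma inK_add n Y (c d : chain n) : inK Y c -> inK Y d -> inK Y (chain_add c d).
Proof.
move=> /inKP[c' cc' c'Y] /inKP[d' dd' d'Y]; apply/inKP; exists (c' ++ d').
  apply/chain_eqP => F; rewrite /chain_add !fsum_cat.
  by move/chain_eqP: cc' => ->; move/chain_eqP: dd' => ->.
exact: supported_cat.
Qed.

Lemma inK_sub n Y (c d : chain n) : inK Y c -> inK Y d -> inK Y (chain_sub c d).
Proof.
move=> cY dY U; rewrite coefE fsum_chain_sub -!coefE.
have [->|cU _] := eqVneq (coef c U) 0; last exact: cY.
by rewrite sub0r oppr_eq0; exact: dY.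
Qed.

(** Since [inK] tests coefficients and not list entries, both hypotheses speak about the same
    cubes. *)
Lemma inK_setD n (A B : set X) (c : chain n) :
  inK (~` B) c -> inK A c -> inK (A `\` B) c.
Proof.
move=> cB cA U cU; have [? ? UA] := cA U cU; have [_ _ UB] := cB U cU.
by split=> // x; split; [exact: UA|exact: UB].
Qed.

(** Operators act by precomposition, hence naturally: they preserve chains in every subset of
    [X]. *)
Definition act m n (L : seq (Rg * ('rV[R]_m -> 'rV[R]_n))) (c : chain n) : chain m :=
  fimage2 1 (fun T f => T \o f \o @clamp R m) c L.

Lemma fsum_act m n L (c : chain n) (F : ('rV[R]_m -> X) -> Rg) :
  fsum (act L c) F = fsum c (fun T => fsum L (fun f => F (T \o f \o @clamp R m))).
Proof. by rewrite fsum_fimage2 mul1r. Qed.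

Lemma act_chain_eq m n (L : seq (Rg * ('rV[R]_m -> 'rV[R]_n))) (c d : chain n) :
  chain_eq c d -> chain_eq (act L c) (act L d).
Proof. by move=> /chain_eqP cd; apply/chain_eqP => F; rewrite !fsum_act cd. Qed.

Lemma inK_act m n K L Y (c : chain n) : 0 < K ->
  supported (@cubelip R K m n) L -> inK Y c -> inK Y (act L c).
Proof.
move=> K0 LK /inKP[d cd dY]; apply/inKP; exists (act L d).
  exact: act_chain_eq.
by apply: supported_fimage2 dY LK => T f; exact: is_cube_comp.
Qed.

Section Boundary.
Variables a b : Rg.

Lemma fsum_bd n (c : chain n.+1) F :
  fsum (bd a b c) F = fsum c (fun T => fsum (bdm R a b n) (fun d => F (T \o d))).
Proof.
rewrite {1}/fsum /bd big_flatten big_map; apply: eq_bigr => p _.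
rewrite big_flatten big_map fsum_bdmE big_enum /= mulr_sumr.
apply: eq_bigr => j _; rewrite !big_cons big_nil /=.
rewrite addr0 /face /=; ring.
Qed.

Lemma bd_chain_eq n (c d : chain n.+1) :
  chain_eq c d -> chain_eq (bd a b c) (bd a b d).
Proof. by move=> /chain_eqP cd; apply/chain_eqP => F; rewrite !fsum_bd cd. Qed.

Lemma inK_bd n Y (c : chain n.+1) : inK Y c -> inK Y (bd a b c).
Proof.
move=> /inKP[d cd dY]; apply/inKP; exists (bd a b d); first exact: bd_chain_eq.
elim: d dY {cd} => // p d IH /supported_cons[pY /IH dY].
rewrite /bd /=; apply: supported_cat => //.
elim: (enum _) => //= j r IHr.
by rewrite !asboolT //; exact: is_cube_face.
Qed.

(** Face inclusions commute with clamping, so the [clamp] inserted by [act] can be moved across the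
    boundary. *)
Lemma fsum_bdm_clamp n (G : ('rV[R]_n -> X) -> Rg) (T : 'rV[R]_n.+1 -> X) :
  fsum (bdm R a b n) (fun d => G ((T \o @clamp R n.+1) \o d)) =
  fsum (bdm R a b n) (fun d => G ((T \o d) \o @clamp R n)).
Proof.
rewrite !fsum_bdmE; apply: eq_bigr => j _.
by congr (_ * (_ * G _ + _ * G _)); apply/funext => z /=;
  [rewrite (clamp_ins j false)|rewrite (clamp_ins j true)].
Qed.

Lemma bd_act_sd n (c : chain n.+1) :
  chain_eq (bd a b (act (sd R Rg n.+1) c)) (act (sd R Rg n) (bd a b c)).
Proof.
apply/chain_eqP => F; rewrite fsum_bd !fsum_act fsum_bd; apply: eq_fsum => T.
rewrite -(sd_bdm a b (fun g => F (T \o g \o @clamp R n))); apply: eq_fsum => s.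
exact: (fsum_bdm_clamp _ (T \o s)).
Qed.

Lemma relcycle_inK Y Z n (c : chain n) : relcycle a b Y Z c -> inK Y c.
Proof. by case: n c => [|n] c // []. Qed.

Lemma act_sd0 (c : chain 0) Y : inK Y c -> chain_eq (act (sd R Rg 0) c) c.
Proof.
move=> /inKP[d cd dY]; apply/chain_eqP => F.
rewrite fsum_act; move/chain_eqP: cd => cd; rewrite !cd.
apply: eq_fsum_supported dY => T [_ Tc _].
rewrite fsum_cons fsum_nil mul1r addr0; congr F.
by apply/funext => z; rewrite [RHS]Tc.
Qed.

Variables x y : Rg.
Hypothesis xayb : x * a + y * b = 1.

Lemma act_hm n Y (c : chain n.+1) F : inK Y c ->
  fsum (bd a b (act (hm R x y n.+1) c)) F + fsum (act (hm R x y n) (bd a b c)) F =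
  fsum (act (sd R Rg n.+1) c) F - fsum c F.
Proof.
move=> /inKP[d /chain_eqP cd dY].
rewrite fsum_bd !fsum_act fsum_bd !cd -fsumD -fsumN -fsumD.
apply: eq_fsum_supported dY => T [_ Tc _].
(* Clamp invariance of the cubes of [c] makes the identity map of the cube act as the identity on
   [c]. *)
have TcE : T = T \o id \o @clamp R n.+1 by apply/funext => z; rewrite [LHS]Tc.
rewrite {4}TcE -(hm_bdm xayb (fun g => F (T \o g \o @clamp R n.+1))).
congr (_ + _); apply: eq_fsum => h.
exact: (fsum_bdm_clamp _ (T \o h)).
Qed.

Lemma relboundary_chain_eq Y Z n (c d : chain n) :
  chain_eq c d -> relboundary a b Y Z d -> relboundary a b Y Z c.
Proof. by move=> cd [u [v [uY vZ dE]]]; exists u, v; split=> // U; rewrite cd. Qed.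

Lemma relboundary_add Y Z n (c d : chain n) :
  relboundary a b Y Z c -> relboundary a b Y Z d ->
  relboundary a b Y Z (chain_add c d).
Proof.
move=> [u [v [uY vZ /chain_eqP cE]]] [u' [v' [uY' vZ' /chain_eqP dE]]].
exists (chain_add u u'), (chain_add v v'); split; [exact: inK_add..|].
apply/chain_eqP => F; move: cE dE; rewrite /chain_add => cE dE.
by rewrite !fsum_cat cE dE !fsum_bd !fsum_cat !fsum_bd addrACA.
Qed.

Lemma relboundary_small Y Z n (c : chain n) : inK Z c -> relboundary a b Y Z c.
Proof.
by move=> cZ; exists [::], c; split; [exact: inK_nil| |].
Qed.

Lemma act_sd_relcycle Y Z n (c : chain n) : relcycle a b Y Z c ->
  relcycle a b Y Z (act (sd R Rg n) c) /\
  relboundary a b Y Z (chain_sub c (act (sd R Rg n) c)).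
Proof.
have half : (0 < 1/2 :> R) by lra.
have inKsd m W (d : chain m) : inK W d -> inK W (act (sd R Rg m) d).
  by apply: (@inK_act m m (1/2)) => //; exact: sd_cubelip.
have inKhm m W (d : chain m) : inK W d -> inK W (act (hm R x y m) d).
  by apply: (@inK_act m.+1 m 2) => //; exact: hm_cubelip.
case: n c => [|n] c => [cY|[cY bZ]].
  split; first exact: inKsd.
  apply: (@relboundary_chain_eq _ _ _ _ [::]); last exact/relboundary_small/inK_nil.
  apply/chain_eqP => F; rewrite fsum_chain_sub fsum_nil.
  by move/chain_eqP: (act_sd0 cY) => ->; rewrite subrr.
split.
  split; first exact: inKsd.
  by apply: inK_chain_eq (bd_act_sd c) _; exact: inKsd.
(* The homotopy gives $c - \mathrm{sd}\,c = \partial(-Hc) + (-H\partial c)$; the last term lies in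
   [Z] because $\partial c$ does. Subtraction from [[::]] is negation. *)
exists (chain_sub [::] (act (hm R x y n.+1) c)),
  (chain_sub [::] (act (hm R x y n) (bd a b c))); split.
- by apply: inK_sub; [exact: inK_nil|exact: inKhm].
- by apply: inK_sub; [exact: inK_nil|exact: inKhm].
apply/chain_eqP => F; rewrite /chain_add fsum_cat fsum_bd !fsum_chain_sub.
rewrite !fsum_nil !sub0r -fsum_bd -opprD (act_hm _ cY); ring.
Qed.

Lemma iter_sd_relcycle Y Z n k (c : chain n) : relcycle a b Y Z c ->
  relcycle a b Y Z (iter k (act (sd R Rg n)) c) /\
  relboundary a b Y Z (chain_sub c (iter k (act (sd R Rg n)) c)).
Proof.
move=> cc; elim: k => [|k [ck bk]] /=.
  split=> //; apply: (@relboundary_chain_eq _ _ _ _ [::]).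
    by apply/chain_eqP => F; rewrite fsum_chain_sub fsum_nil subrr.
  exact/relboundary_small/inK_nil.
have [ck' bk'] := act_sd_relcycle ck; split=> //.
(* Telescoping: the difference for [k] steps plus the difference made by one more. *)
apply: relboundary_chain_eq (relboundary_add bk bk').
apply/chain_eqP => F; rewrite /chain_add fsum_cat !fsum_chain_sub; ring.
Qed.

End Boundary.

Lemma inK_iter_sd n k Y (c : chain n) : inK Y c -> inK Y (iter k (act (sd R Rg n)) c).
Proof.
move=> cY; elim: k => //= k; apply: (@inK_act n n (1/2)); first lra.
exact: sd_cubelip.
Qed.

Lemma iter_sd_chain_eq n k (c d : chain n) : chain_eq c d ->
  chain_eq (iter k (act (sd R Rg n)) c) (iter k (act (sd R Rg n)) d).
Proof. by move=> cd; elim: k => //= k; exact: act_chain_eq. Qed.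

Lemma bd_iter_sd a b n k (c : chain n.+1) :
  chain_eq (bd a b (iter k (act (sd R Rg n.+1)) c))
           (iter k (act (sd R Rg n)) (bd a b c)).
Proof.
elim: k => //= k /chain_eqP IH; apply/chain_eqP => F.
move: (bd_act_sd a b (iter k (act (sd R Rg n.+1)) c)) => /chain_eqP ->.
by rewrite !fsum_act IH.
Qed.

Lemma iter_sd_cat n k (c d : chain n) :
  chain_eq (iter k (act (sd R Rg n)) (c ++ d))
           (iter k (act (sd R Rg n)) c ++ iter k (act (sd R Rg n)) d).
Proof.
apply/chain_eqP; elim: k => //= k IH F.
by rewrite fsum_act IH fsum_cat [RHS]fsum_cat !fsum_act.
Qed.

(** * Subdividing chains until they are small *)

Section Small.
Variables A B : set X.

Lemma iter_sd_small n k d (c : chain n) : 0 < d -> 1 <= 2 ^+ k * d ->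
  supported (fun T => is_cube setT T /\ lebesgue A B d T) c ->
  supported (fun T => is_cube (~` B) T \/ is_cube A T)
    (iter k (act (sd R Rg n)) c).
Proof.
elim: k d c => [|k IH] d c d0 /= kd sc.
  apply: sub_supported sc => T [cT lT].
  by apply: lebesgue1 lT => //; rewrite mul1r in kd.
(* The innermost subdivision is peeled off, so that the induction hypothesis applies to the once
   subdivided chain with [2 * d]. *)
rewrite -iterS iterSr; apply: (IH (2 * d)); first by rewrite mulr_gt0.
  by rewrite mulrA -exprSr.
apply: supported_fimage2 sc (sd_cubelip R Rg n) => T f [cT lT] fK; split.
  by apply: is_cube_comp fK => //; lra.
by apply: lebesgue_comp => //; exact: ltW.
Qed.

Hypothesis BA : closure B `<=` interior A.

Lemma exists_lebesgue_chain n (c : chain n) : supported (is_cube setT) c ->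
  exists2 d : R, 0 < d &
    supported (fun T => is_cube setT T /\ lebesgue A B d T) c.
Proof.
elim: c => [|p c IH]; first by exists 1.
move=> /supported_cons[cp /IH[d d0 sc]].
have [e e0 le] := exists_lebesgue BA cp.
exists (Num.min d e); first by rewrite lt_min d0.
apply/supported_cons; split.
  by split=> //; apply: lebesgue_le le; rewrite ge_min lexx orbT.
apply: sub_supported sc => T [? lT]; split=> //.
by apply: lebesgue_le lT; rewrite ge_min lexx.
Qed.

Lemma exists_small n (c : chain n) : inK setT c ->
  exists k c1 c2, [/\ inK (~` B) c1, inK A c2 &
    chain_eq (iter k (act (sd R Rg n)) c) (chain_add c1 c2)].
Proof.
move=> /inKP[c' cc' /exists_lebesgue_chain[d d0 sc]].
(* By the Archimedean property [k] bounds the inverse of [d], and $2^k > k$. *)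
pose k := Num.bound d^-1.
have kd : 1 <= 2 ^+ k * d.
  rewrite -ler_pdivrMr // div1r; apply: ltW.
  apply: lt_le_trans (archi_boundP _) _; first by rewrite invr_ge0 ltW.
  by rewrite -natrX ler_nat ltnW // ltn_expl.
have := iter_sd_small d0 kd sc; set e := iter _ _ _ => se.
(* Cubes avoiding [B] go into the first part, even if they also lie in [A]; every remaining cube
   must lie in [A]. *)
pose P (p : Rg * ('rV[R]_n -> X)) := `[< is_cube (~` B) p.2 >].
exists k, [seq p <- e | P p], [seq p <- e | ~~ P p]; split.
- apply/inKP; exists [seq p <- e | P p] => //; exact: filter_all.
- apply/inKP; exists [seq p <- e | ~~ P p] => //.
  elim: (e) se => // p r IHr /supported_cons[pS /IHr rS] /=.
  case: ifPn => // /asboolP nB; apply/supported_cons; split=> //.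
  by case: pS.
apply/chain_eqP => F; rewrite /chain_add fsum_cat.
have /chain_eqP -> := iter_sd_chain_eq k cc'; rewrite -/e.
by rewrite /fsum !big_filter (bigID P).
Qed.

End Small.
End Chains.

(** * Excision *)

Theorem mainTheorem5 (R : realType) (Rg : comNzRingType) (X : topologicalType)
  (A B : set X) (a b : Rg) :
  B `<=` A -> closure B `<=` interior A -> NCD a b ->
  forall n : nat,
    induced_iso R a b (~` B) (A `\` B) setT A n.
Proof.
move=> _ BA /(_ 1)[x [y xayb]] n; rewrite !expr1 in xayb.
split=> [c c' cc cc' [d [e [dX eA cE]]]|z zz].
  (* Relative cycles are closed under differences, so injectivity concerns a single relative cycle
     that bounds in the larger pair. *)
  have {cc cc'} : relcycle a b (~` B) (A `\` B) (chain_sub c c').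
    case: n c c' cc cc' {d e dX eA cE} => [|n] c c'; first exact: inK_sub.
    move=> [cY cZ] [cY' cZ']; split; first exact: inK_sub.
    apply: (@inK_chain_eq _ _ _ _ _ _ (chain_sub (bd a b c) (bd a b c'))).
      by apply/chain_eqP => F; rewrite fsum_bd !fsum_chain_sub !fsum_bd.
    exact: inK_sub.
  move: (chain_sub c c') cE => {c c'}c cE cc.
  have [k [d1 [d2 [d1B d2A dE]]]] := exists_small BA dX.
  have [ck bk] := iter_sd_relcycle xayb k cc.
  have cB := relcycle_inK ck.
  (* With $\mathrm{sd}^k d = d_1 + d_2$, the chain $r = \mathrm{sd}^k c - \partial d_1$ also equals
     $\partial d_2 + \mathrm{sd}^k e$. The first form avoids [B] and the second lies in [A], so [r]
     is a chain in the difference. *)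
  pose r := chain_sub (iter k (act (sd R Rg n)) c) (bd a b d1).
  have rE : chain_eq r (chain_add (bd a b d2) (iter k (act (sd R Rg n)) e)).
    apply/chain_eqP => F; rewrite /chain_add fsum_cat fsum_chain_sub.
    have /chain_eqP -> := iter_sd_chain_eq k cE.
    have /chain_eqP -> := iter_sd_cat k (bd a b d) e.
    rewrite fsum_cat; have /chain_eqP <- := bd_iter_sd a b k d.
    have /chain_eqP -> := bd_chain_eq a b dE.
    rewrite fsum_bd /chain_add fsum_cat -!fsum_bd; ring.
  have rD : inK (A `\` B) r.
    apply: inK_setD; first by apply: inK_sub => //; exact: inK_bd.
    apply: inK_chain_eq rE _; apply: inK_add; first exact: inK_bd.
    exact: inK_iter_sd.
  (* Here $c = (c - \mathrm{sd}^k c) + (\partial d_1 + r)$, and both summands are relative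
     boundaries of the smaller pair. *)
  apply: relboundary_chain_eq (relboundary_add bk _); last first.
    exists d1, r; split; [exact: d1B|exact: rD|].
    by move=> U; reflexivity.
  apply/chain_eqP => F; rewrite /chain_add fsum_cat fsum_chain_sub fsum_cat.
  rewrite fsum_chain_sub; ring.
(* Surjectivity: $\mathrm{sd}^k z = c + e$ with [e] in [A], so the part [c] avoiding [B] represents
   the class of [z]. *)
have [k [c [e [cB eA zE]]]] := exists_small BA (relcycle_inK zz).
have [zk bk] := iter_sd_relcycle xayb k zz.
exists c; split; last first.
  apply: relboundary_chain_eq (relboundary_add bk (relboundary_small a b setT eA)).
  apply/chain_eqP => F; rewrite /chain_add fsum_cat !fsum_chain_sub.
  have /chain_eqP -> := zE; rewrite fsum_cat; ring.
case: n z c e {zz bk} cB eA zE zk => [|n] z c e // cB eA zE [_ bzA].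
(* The boundary of [c] avoids [B] because [c] does, and lies in [A] because it equals
   $\partial\,\mathrm{sd}^k z - \partial e$. *)
split=> //; apply: inK_setD; first exact: inK_bd.
apply: (@inK_chain_eq _ _ _ _ _ _
  (chain_sub (bd a b (iter k (act (sd R Rg n.+1)) z)) (bd a b e))).
  apply/chain_eqP => F; rewrite fsum_chain_sub.
  have /chain_eqP -> := bd_chain_eq a b zE.
  rewrite !fsum_bd /chain_add fsum_cat; ring.
by apply: inK_sub => //; exact: inK_bd.
Qed.
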